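(* Let $\{(a_n,b_n,c_n)\}_{n=1}^\infty$ be a sequence of abc-triples, let $N_n=\mathrm{rad}(a_nb_nc_n)$ and $\omega_n=\omega(a_nb_nc_n)$, and let $\eta_n$ be the packing efficiency of $(a_n,b_n,c_n)$. For any $\alpha>0$, the standard quality $q_{s,n}:=\ln(c_n)/\ln(N_n)$ satisfies $$q_{s,n}=q_C(a_n,b_n,c_n;\alpha,1)\cdot\omega_n^{\alpha-1}\cdot\eta_n .$$ Consequently, if $\omega_n\sim\delta(\ln c_n)^\gamma$ for constants $\delta>0$ and $0<\gamma<1$, with $\alpha=1/\gamma$, then $$\limsup_{n\to\infty}q_{s,n}\ \le\ \left(\frac{1}{\delta^{1/\gamma}\ln 2}\right)\cdot\limsup_{n\to\infty}\left(\omega_n^{\frac{1-\gamma}{\gamma}}\cdot\eta_n\right).$$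
   Context: An abc-triple is a triple $(a,b,c)$ of positive integers with $a+b=c$ and $\gcd(a,b)=\gcd(b,c)=\gcd(a,c)=1$; $\omega=\omega(abc)$ is the number of distinct primes $p_1,\dots,p_{\omega}$ dividing $abc$, and $\mathrm{rad}(n)$ is the product of the distinct primes dividing $n$. For $\alpha\ge0$, $\beta>0$, the DGM quality class is $$q_C(a,b,c;\alpha,\beta)=\frac{\ln c}{(\ln \mathrm{DGM}(U))^\beta},\qquad U=\{p_i^{\omega^\alpha}: p_i\mid abc,\ p_i\text{ prime}\},$$ where $\mathrm{DGM}(\{x_1,\dots,x_m\})=\exp(\exp(\tfrac1m\sum_{i}\ln\ln x_i))$; equivalently $q_C(a,b,c;\alpha,\beta)=\ln c\,\big/\,\big(\omega^\alpha(\prod_{i=1}^{\omega}\ln p_i)^{1/\omega}\big)^\beta$. The packing efficiency of an abc-triple is $\eta=G/A$, where $A=\frac1\omega\sum_{i=1}^\omega\ln p_i$ and $G=\big(\prod_{i=1}^\omega\ln p_i\big)^{1/\omega}$. The notation $x_n\sim y_n$ means $x_n/y_n\to1$ as $n\to\infty$. *)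

(* Defs.v *)
From mathcomp Require Import all_boot all_order all_algebra.
From mathcomp Require Import all_classical all_reals all_analysis.
Import Order.TTheory GRing.Theory Num.Theory.
Import numFieldNormedType.Exports.

Set Implicit Arguments.
Unset Strict Implicit.
Unset Printing Implicit Defensive.

Local Open Scope ring_scope.
Local Open Scope classical_set_scope.

Definition abc_triple (a b c : nat) : bool :=
  [&& (0 < a)%N, (0 < b)%N, (0 < c)%N, (a + b)%N == c,
      coprime a b, coprime b c & coprime a c].

Definition omega (n : nat) : nat := size (primes n).

Definition rad (n : nat) : nat := (\prod_(p <- primes n) p)%N.

(* The argument lists the elements of a finite set, without repetition. The
   logarithm of MathComp-Analysis is 0 on nonpositive numbers, so this is the
   usual expression only when every x > 1. *)
Definition DGM (R : realType) (s : seq R) : R :=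
  expR (expR ((size s)%:R^-1 * \sum_(x <- s) ln (ln x))).

(* The set U. No value is repeated: [primes n] is duplicate-free and, for n > 1,
   the exponent is positive, so p |-> p `^ (omega n `^ alpha) is injective. *)
Definition prime_powers (R : realType) (n : nat) (alpha : R) : seq R :=
  [seq p%:R `^ ((omega n)%:R `^ alpha) | p <- primes n].

Definition quality_C (R : realType) (a b c : nat) (alpha beta : R) : R :=
  ln c%:R / (ln (DGM (prime_powers (a * b * c) alpha))) `^ beta.

Definition quality_s (R : realType) (a b c : nat) : R :=
  ln c%:R / ln (rad (a * b * c))%:R.

Definition log_amean (R : realType) (n : nat) : R :=
  (omega n)%:R^-1 * \sum_(p <- primes n) ln p%:R.

Definition log_gmean (R : realType) (n : nat) : R :=
  (\prod_(p <- primes n) ln p%:R) `^ (omega n)%:R^-1.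

Definition packing_efficiency (R : realType) (a b c : nat) : R :=
  log_gmean R (a * b * c) / log_amean R (a * b * c).

Definition asymp_equiv (R : realType) (x y : nat -> R) : Prop :=
  (fun n => x n / y n) @ \oo --> (1 : R).

(* Main.v *)
Require Import Defs.
From mathcomp Require Import all_boot all_order all_algebra.
From mathcomp Require Import all_classical all_reals all_analysis.
From mathcomp Require Import ring lra.
Import Order.TTheory GRing.Theory Num.Theory.
Import numFieldNormedType.Exports.
Local Open Scope ring_scope.

(** Since ln DGM(U) = omega^alpha G and ln N = omega A, the factorization of q_s
    is an identity between ln c, omega, G and A. As every prime is at least 2,
    G >= ln 2, so q_C(.; alpha, 1) <= ln c / (omega^alpha ln 2); for
    alpha = 1/gamma the right-hand side converges to
    1 / (delta^(1/gamma) ln 2), and multiplying a nonnegative sequence by one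
    converging to l > 0 multiplies its limsup by at most l. *)

Set Implicit Arguments.
Unset Strict Implicit.

(** * Upper limits along a filter *)

Lemma le_limf_esup {T : choiceType} {X : filteredType T} {R : realType}
    (F : set_system X) {FF : Filter F} (f g : X -> \bar R) :
  (\forall x \near F, f x <= g x)%E -> (limf_esup f F <= limf_esup g F)%E.
Proof.
move=> fg; apply: le_ereal_inf_tmp => _ [V FV <-].
(* Cutting [V] down to the points where [f x <= g x] stays in [F], and on the smaller set the
   supremum of [f] is at most that of [g] on [V]. *)
apply: ge_ereal_inf; exists (ereal_sup (f @` (V `&` [set x | f x <= g x]%E)))%classic.
  by exists (V `&` [set x | f x <= g x]%E)%classic => //; exact: filterI.
apply: ge_ereal_sup => _ [x [Vx fgx] <-].
by apply: le_trans fgx _; apply: ereal_sup_ubound; exists x.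
Qed.

Lemma limf_esup_pZl {T : choiceType} {X : filteredType T} {R : realType}
    (F : set_system X) (f : X -> \bar R) (r : R) : 0 < r ->
  limf_esup (fun x => r%:E * f x)%E F = (r%:E * limf_esup f F)%E.
Proof.
move=> r0; rewrite /limf_esup -ereal_inf_pZl// image_comp; congr ereal_inf.
by apply: eq_imagel => V _ /=; rewrite -ereal_sup_pZl// image_comp.
Qed.

(** For each [k > l], eventually [u x <= k], and [v >= 0] allows multiplying by [v x]; then [k]
    decreases to [l]. *)
Lemma limf_esupM_le {T : choiceType} {X : filteredType T} {R : realType}
    (F : set_system X) {FF : ProperFilter F} (u v : X -> R) (l : R) : 0 < l ->
  (u @ F --> l)%classic -> (forall x, 0 <= v x) ->
  (limf_esup (fun x => (u x * v x)%:E) F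
   <= l%:E * limf_esup (fun x => (v x)%:E) F)%E.
Proof.
move=> l0 ul v0.
have le_k k : l < k ->
    (limf_esup (fun x => (u x * v x)%:E) F
     <= k%:E * limf_esup (fun x => (v x)%:E) F)%E.
  move=> lk; rewrite -limf_esup_pZl ?(lt_trans l0)//.
  apply: le_limf_esup; near=> x; rewrite -EFinM lee_fin ler_wpM2r//.
  by apply/ltW; near: x; exact: (cvgr_lt _ ul).
have: (0 <= limf_esup (fun x => (v x)%:E) F)%E.
  by apply: limf_esup_ge0 => [|x]; [exact: filter_not_empty | rewrite lee_fin].
set V := limf_esup (fun x => (v x)%:E) F in le_k *.
(* Nonnegativity excludes [-oo]; for [+oo] the bound is [+oo] because [0 < l]. *)
case: V le_k => [M| |//] le_k; last by rewrite gt0_muley ?leey.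
rewrite lee_fin => M0; apply/lee_addgt0Pr => e e0.
have M1 : 0 < M + 1 by lra.
(* The denominator is [M + 1] because [M] may be 0; the excess [e * M / (M + 1)] is at most [e]. *)
have d0 : 0 < e / (M + 1) by rewrite divr_gt0.
apply: le_trans (le_k (l + e / (M + 1)) _) _; first by lra.
rewrite -!EFinM -EFinD lee_fin mulrDl lerD2l -mulrA.
by rewrite ler_piMr ?ltW// mulrC ltr_pdivrMr// mul1r; lra.
Unshelve. all: by end_near. Qed.

(** * Primes of [n], their logarithms and the two means *)

Lemma omega_gt0 n : (1 < n)%N -> (0 < omega n)%N.
Proof.
move=> n1; rewrite /omega -has_predT; apply/hasP; exists (pdiv n) => //.
by rewrite mem_primes pdiv_prime// pdiv_dvd (ltnW n1).
Qed.

Lemma prime_ge2 n p : p \in primes n -> (2 <= p)%N.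
Proof. by rewrite mem_primes => /andP[/prime_gt1]. Qed.

Section logs.
Context {R : realType}.
Implicit Types (n p : nat) (alpha : R).

Lemma ln_prime_gt0 n p : p \in primes n -> 0 < ln p%:R :> R.
Proof. by move=> /prime_ge2 p2; rewrite ln_gt0// ltr1n. Qed.

Lemma ln2_le_ln_prime n p : p \in primes n -> ln 2 <= ln p%:R :> R.
Proof.
by move=> /prime_ge2 p2; rewrite ler_ln ?posrE ?ler_nat// ltr0n (leq_trans _ p2).
Qed.

Lemma ln_prod_seq (I : eqType) (s : seq I) (f : I -> R) :
  {in s, forall i, 0 < f i} -> ln (\prod_(i <- s) f i) = \sum_(i <- s) ln (f i).
Proof.
elim: s => [|i s IH] s0; first by rewrite !big_nil ln1.
have s0' : {in s, forall j, 0 < f j} by move=> j js; rewrite s0// inE js orbT.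
rewrite !big_cons lnM ?posrE ?s0 ?mem_head// ?IH//.
by rewrite big_seq prodr_gt0.
Qed.

Lemma ln_rad n : ln (Defs.rad n)%:R = \sum_(p <- primes n) ln p%:R :> R.
Proof.
rewrite /Defs.rad natr_prod ln_prod_seq// => p /prime_ge2 p2.
by rewrite ltr0n (leq_trans _ p2).
Qed.

Lemma log_ameanE n : (1 < n)%N -> (omega n)%:R * log_amean R n = ln (Defs.rad n)%:R.
Proof.
move=> n1; rewrite /log_amean mulrA mulfV ?mul1r ?ln_rad//.
by rewrite pnatr_eq0 -lt0n omega_gt0.
Qed.

Lemma ln_rad_gt0 n : (1 < n)%N -> 0 < ln (Defs.rad n)%:R :> R.
Proof.
move=> n1; rewrite ln_rad.
move: (omega_gt0 n1) (@ln_prime_gt0 n); rewrite /omega.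
case: (primes n) => // p s _ s0; rewrite big_cons ltr_pwDl ?s0 ?mem_head//.
by rewrite big_seq sumr_ge0// => q qs; rewrite ltW// s0// inE qs orbT.
Qed.

Lemma log_amean_gt0 n : (1 < n)%N -> 0 < log_amean R n.
Proof.
move=> n1; rewrite /log_amean -ln_rad mulr_gt0 ?ln_rad_gt0//.
by rewrite invr_gt0 ltr0n omega_gt0.
Qed.

(** Averaging [ln (ln p)] is also what [DGM] does, so this form serves both to evaluate [DGM] and to
    bound G from below. *)
Lemma log_gmeanE n :
  log_gmean R n = expR ((omega n)%:R^-1 * \sum_(p <- primes n) ln (ln p%:R)).
Proof.
rewrite -ln_prod_seq; last exact: ln_prime_gt0.
rewrite /log_gmean /powR gt_eqF// big_seq prodr_gt0// => p.
exact: ln_prime_gt0.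
Qed.

Lemma log_gmean_gt0 n : 0 < log_gmean R n.
Proof. by rewrite log_gmeanE expR_gt0. Qed.

Lemma ln2_le_log_gmean n : (1 < n)%N -> ln 2 <= log_gmean R n.
Proof.
move=> n1; have ln2 : 0 < ln 2 :> R by rewrite ln_gt0// ltr1n.
have w0 : (omega n)%:R != 0 :> R by rewrite pnatr_eq0 -lt0n omega_gt0.
rewrite log_gmeanE -[leLHS]lnK ?posrE// ler_expR mulrC.
rewrite ler_pdivlMr ?ltr0n ?omega_gt0// mulrC.
(* The multiple of [ln (ln 2)] becomes a constant sum over [primes n], to be compared term by
   term. *)
rewrite mulr_natl /omega -count_predT -iter_addr_0 -big_const_seq.
rewrite [leLHS]big_seq [leRHS]big_seq.
apply: ler_sum => p pn; rewrite ler_ln ?posrE//; first exact: ln2_le_ln_prime pn.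
exact: ln_prime_gt0 pn.
Qed.

(** With w = [omega n], the double logarithm of p^(w^alpha) is ln(w^alpha) + ln ln p. The first term
    is the same for all w primes, so the mean preserves it and the inner exponential turns it into
    the factor w^alpha; [ln] cancels the outer one. *)
Lemma ln_DGM_prime_powers n alpha : (1 < n)%N ->
  ln (DGM (prime_powers n alpha)) = (omega n)%:R `^ alpha * log_gmean R n.
Proof.
move=> n1; have w0 : 0 < (omega n)%:R :> R by rewrite ltr0n omega_gt0.
rewrite /DGM expRK /prime_powers size_map big_map.
rewrite big_seq (eq_bigr (fun p => ln ((omega n)%:R `^ alpha) + ln (ln p%:R))).
  rewrite -big_seq big_split/= big_const_seq iter_addr_0 count_predT -/(omega n) mulrDr.
  by rewrite -[X in _^-1 * X + _]mulr_natl mulKf ?gt_eqF// expRD lnK ?posrE ?powR_gt0// -log_gmeanE.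
move=> p pn; rewrite ln_powR lnM// posrE ?powR_gt0//.
exact: ln_prime_gt0 pn.
Qed.

Lemma quality_C1E a b c alpha : (1 < a * b * c)%N ->
  quality_C a b c alpha 1
  = ln c%:R / ((omega (a * b * c))%:R `^ alpha * log_gmean R (a * b * c)).
Proof.
move=> n1; rewrite /quality_C ln_DGM_prime_powers// powRr1//.
by rewrite mulr_ge0 ?powR_ge0// ltW// log_gmean_gt0.
Qed.

Lemma quality_s_factor a b c alpha : (1 < a * b * c)%N ->
  quality_s R a b c
  = quality_C a b c alpha 1 * (omega (a * b * c))%:R `^ (alpha - 1)
    * packing_efficiency R a b c.
Proof.
move=> n1; have w0 : 0 < (omega (a * b * c))%:R :> R by rewrite ltr0n omega_gt0.
rewrite /quality_s quality_C1E// /packing_efficiency -log_ameanE//.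
rewrite powRB ?(gt_eqF w0) ?implybT// powRr1 ?(ltW w0)//.
have := powR_gt0 alpha w0; have := log_gmean_gt0 (a * b * c).
have := log_amean_gt0 n1.
by move=> A0 G0 P0; field; rewrite !gt_eqF.
Qed.

Lemma packing_efficiency_ge0 a b c : (1 < a * b * c)%N ->
  0 <= packing_efficiency R a b c.
Proof.
by move=> n1; rewrite divr_ge0// ltW// ?log_gmean_gt0// log_amean_gt0.
Qed.

Lemma quality_C1_le a b c alpha : (1 < a * b * c)%N -> (0 < c)%N ->
  quality_C a b c alpha 1 <= ln c%:R / ((omega (a * b * c))%:R `^ alpha * ln 2).
Proof.
move=> n1 c0; have w0 : 0 < (omega (a * b * c))%:R :> R by rewrite ltr0n omega_gt0.
have ln2 : 0 < ln 2 :> R by rewrite ln_gt0// ltr1n.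
have P0 := powR_gt0 alpha w0.
rewrite quality_C1E// ler_wpM2l ?ln_ge0 ?ler1n// lef_pV2 ?posrE ?mulr_gt0//.
  by rewrite ler_pM2l// ln2_le_log_gmean.
exact: log_gmean_gt0.
Qed.

(** Away from base 0, [powR] is [expR (r * ln x)], and [f] is eventually positive since its limit
    is; continuity of [ln] at [x] and of [expR] concludes, for [r] of any sign. *)
Lemma cvg_powR {T : Type} {F : set_system T} {FF : Filter F} (f : T -> R) (x r : R) :
  0 < x -> (f @ F --> x)%classic -> (f t `^ r @[t --> F] --> x `^ r)%classic.
Proof.
move=> x0 fx; have f0 : \forall t \near F, 0 < f t by exact: (cvgr_gt _ fx).
have -> : x `^ r = expR (r * ln x) by rewrite /powR gt_eqF.
apply: (cvg_trans (G := (expR (r * ln (f t)) @[t --> F])%classic)).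
  apply: near_eq_cvg; near=> t.
  by rewrite /powR gt_eqF//; near: t.
apply: (cvg_comp _ expR _ (@continuous_expR R _)); apply: cvgMl_tmp.
exact: (cvg_comp _ _ fx (continuous_ln x0)).
Unshelve. all: by end_near. Qed.

End logs.

(** Here c = a + b >= 2 and abc >= c. Hence [omega] and [ln c] are positive in what follows, and no
    division by 0 occurs. *)
Lemma abc_triple_gt1 a b c : abc_triple a b c -> (1 < c)%N && (1 < a * b * c)%N.
Proof.
case/and5P => a0 b0 c0 /eqP <- _.
have c1 : (1 < a + b)%N by rewrite -(addn1 1) leq_add.
by rewrite c1 (leq_trans c1)// leq_pmull// muln_gt0 a0.
Qed.

Unset Implicit Arguments.
Set Strict Implicit.

Theorem theorem4p13 (R : realType) (a b c : nat -> nat)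
    (habc : forall n, abc_triple (a n) (b n) (c n)) :
  (forall (alpha : R), 0 < alpha -> forall n : nat,
     quality_s R (a n) (b n) (c n)
     = quality_C (a n) (b n) (c n) alpha 1
       * (omega (a n * b n * c n))%:R `^ (alpha - 1)
       * packing_efficiency R (a n) (b n) (c n))
  /\
  (forall (delta gamma : R), 0 < delta -> 0 < gamma -> gamma < 1 ->
     asymp_equiv (fun n => (omega (a n * b n * c n))%:R)
                 (fun n => delta * (ln (c n)%:R) `^ gamma) ->
     (limn_esup (fun n => (quality_s R (a n) (b n) (c n))%:E)
      <= (1 / (delta `^ (1 / gamma) * ln 2))%:E
         * limn_esup (fun n =>
             ((omega (a n * b n * c n))%:R `^ ((1 - gamma) / gamma)
              * packing_efficiency R (a n) (b n) (c n))%:E))%E).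
Proof.
have abc1 n : (1 < a n * b n * c n)%N by case/andP: (abc_triple_gt1 (habc n)).
have c1 n : (1 < c n)%N by case/andP: (abc_triple_gt1 (habc n)).
split=> [alpha _ n|delta gamma d0 g0 g1 wlnc]; first exact: quality_s_factor.
have ln2 : 0 < ln 2 :> R by rewrite ln_gt0// ltr1n.
set alpha := 1 / gamma; set w := fun n => (omega (a n * b n * c n))%:R : R.
set C := 1 / _.
have C0 : 0 < C by rewrite divr_gt0// mulr_gt0// powR_gt0.
pose r n := w n / (delta * ln (c n)%:R `^ gamma).
have rC : (C * r n `^ (- alpha) @[n --> \oo] --> C)%classic.
  have := @cvgMl_tmp _ _ _ _ _ C _ (cvg_powR (r := - alpha) ltr01 wlnc).
  by rewrite powR1 mulr1; apply.
have le_q n : quality_s R (a n) (b n) (c n)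
    <= C * r n `^ (- alpha) * (w n `^ ((1 - gamma) / gamma)
         * packing_efficiency R (a n) (b n) (c n)).
  have w0 : 0 < w n by rewrite ltr0n omega_gt0.
  have L0 : 0 < ln (c n)%:R :> R by rewrite ln_gt0// ltr1n.
  rewrite (@quality_s_factor _ _ _ _ alpha)//.
  have -> : (1 - gamma) / gamma = alpha - 1 by rewrite /alpha; field; rewrite gt_eqF.
  rewrite -mulrA ler_wpM2r//.
    by rewrite mulr_ge0 ?powR_ge0 ?packing_efficiency_ge0.
  (* Since alpha * gamma = 1, raising w = r * delta * (ln c)^gamma to the power alpha gives r^alpha
     * delta^alpha * ln c, and [ln c] cancels. *)
  have -> : C * r n `^ (- alpha) = ln (c n)%:R / (w n `^ alpha * ln 2).
    have P0 : 0 < delta * ln (c n)%:R `^ gamma by rewrite mulr_gt0 ?powR_gt0.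
    have r0 : 0 < r n by exact: divr_gt0.
    have -> : w n `^ alpha = r n `^ alpha * (delta `^ alpha * ln (c n)%:R).
      rewrite -[w n](divfK (lt0r_neq0 P0)) -/(r n) (powRM _ (ltW r0) (ltW P0)).
      by rewrite (powRM _ (ltW d0)) ?powR_ge0// -powRrM
         /alpha div1r mulfV ?(gt_eqF g0)// powRr1 ?ltW.
    have D0 := powR_gt0 alpha d0; have ra0 := powR_gt0 alpha r0.
    by rewrite powRN /C; field; rewrite !gt_eqF.
  by rewrite quality_C1_le// ltnW.
apply: (le_trans _ (limf_esupM_le C0 rC _)).
  by apply: le_limf_esup; apply: nearW => n; rewrite lee_fin.
by move=> n; rewrite mulr_ge0 ?powR_ge0 ?packing_efficiency_ge0.
Qed.
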